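(* There exists an absolute positive constant $\kappa$ such that the following holds. Let $h\in[0,1]$, let $\mathcal{A}$ be a VC-class of measurable subsets of $\mathcal{X}$ with dimension $V\ge2$, and let $S=\{\mathbb{1}_A: A\in\mathcal{A}\}$. Then, if $n\ge V$, $$R_n(h,S)\ge\kappa\left[\left(\frac{V}{nh}\right)\wedge\sqrt{\frac{V}{n}}\right],$$ where $R_n(h,S)=\inf_{\hat s\in S}\sup_{P\in\mathcal{P}(h,S)}\mathbb{E}[\ell(s^*,\hat s)]$ is the minimax risk over $\mathcal{P}(h,S)$.
   Context: Binary classification setting: one observes $n$ independent copies $(X_1,Y_1),\dots,(X_n,Y_n)$ of a pair $(X,Y)$ with distribution $P$ on $\mathcal{X}\times\{0,1\}$, $\mathcal{X}$ a measurable space. A classifier is a measurable map $t:\mathcal{X}\to\{0,1\}$; $\eta(x)=P[Y=1\mid X=x]$ is the regression function, $s^*(x)=\mathbb{1}_{\eta(x)\ge1/2}$ is the Bayes classifier (both depend on $P$), and $\ell(s^*,t)=P(Y\ne t(X))-P(Y\ne s^*(X))$. $\mathcal{P}(h,S)$ is the set of probability distributions $P$ on $\mathcal{X}\times\{0,1\}$ such that $|2\eta(x)-1|\ge h$ for all $x\in\mathcal{X}$ and $s^*\in S$. In the definition of $R_n(h,S)$ the infimum is over all estimators $\hat s$ based on the $n$-sample and taking their values in $S$; the expectation is under the sample having distribution $P^{\otimes n}$. VC-dimension: with $m_{\mathcal{A}}(N)$ the supremum of $\#\{A\cap C: A\in\mathcal{A}\}$ over subsets $C\subset\mathcal{X}$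 of cardinality $N$, $V=\sup\{N: m_{\mathcal{A}}(N)=2^N\}$, and $\mathcal{A}$ is a VC-class if $V<\infty$. $a\wedge b=\min(a,b)$; for $h=0$, $V/(nh)$ is read as $+\infty$. *)

(* Defs.v *)
From HB Require Import structures.
From mathcomp Require Import all_boot all_order all_algebra.
From mathcomp Require Import all_classical all_reals all_analysis.

Set Implicit Arguments.
Unset Strict Implicit.
Unset Printing Implicit Defensive.

Import Order.TTheory GRing.Theory Num.Theory.

Local Open Scope classical_set_scope.
Local Open Scope ring_scope.

Section product_law.
Context {d : measure_display} {T : measurableType d} {R : realType}.

Definition cons_pair (n : nat) (z : T * n.-tuple T) : n.+1.-tuple T :=
  [tuple of z.1 :: z.2].

Lemma measurable_cons_pair (n : nat) :
  measurable_fun [set: T * n.-tuple T] (@cons_pair n).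
Proof. exact: measurable_cons measurable_fst measurable_snd. Qed.

HB.instance Definition _ (n : nat) :=
  isMeasurableFun.Build _ _ _ _ (@cons_pair n) (@measurable_cons_pair n).

(* n-fold product measure on tuples; [sample_law_rect] below is its
   characteristic property. *)
Fixpoint sample_law (P : probability T R) (n : nat) :
    probability (n.-tuple T) R :=
  match n with
  | 0%N => \d_ [tuple]
  | m.+1 => distribution (P \x sample_law P m)%E
              [the {mfun _ >-> _} of @cons_pair m]
  end.

Lemma sample_law_rect (P : probability T R) (n : nat) (B : 'I_n -> set T) :
  (forall i, measurable (B i)) ->
  sample_law P n [set D | forall i, B i (tnth D i)] = (\prod_(i < n) P (B i))%E.
Proof.
elim: n B => [|n IH] B mB /=.
  by rewrite big_ord0 diracE mem_set// => -[].
pose B' (i : 'I_n) := B (lift ord0 i).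
set E := [set D : n.-tuple T | forall i, B' i (tnth D i)].
have mE : measurable E.
  have -> : E = \bigcap_(i in [set: 'I_n]) ((@tnth n T)^~ i @^-1` B' i).
    by apply/seteqP; split => D /= DE i; [move=> _; exact: DE|exact: DE].
  apply: fin_bigcap_measurable; first exact: finite_finset.
  move=> i _; rewrite -[X in measurable X]setTI.
  by apply: measurable_tnth => //; exact: mB.
rewrite /distribution /pushforward/= big_ord_recl -IH//.
rewrite -product_measure1E//; congr ((P \x _)%E _).
apply/seteqP; split => -[x D]/= H.
  split; first by have := H ord0; rewrite tnth0.
  by move=> i; have := H (lift ord0 i); rewrite tnthS.
by move=> i; case: (unliftP ord0 i) => [j|] ->; rewrite ?tnthS ?tnth0;
  [exact: H.2|exact: H.1].
Qed.

End product_law.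

Section vc_dimension.
Context {d : measure_display} {X : measurableType d} (R : realType).
Implicit Type A : set (set X).

(* m_A(N); it is -oo when X has fewer than N points. *)
Definition shatter_coeff A (N : nat) : \bar R :=
  ereal_sup [set counting [set B `&` C | B in A] | C in [set C | (C #= `I_N)%card]].

Definition vc_dim A : \bar R :=
  ereal_sup [set N%:R%:E | N in [set N | shatter_coeff A N = (2 ^ N)%:R%:E]].

Definition indicators A : set (X -> bool) :=
  [set (fun x => x \in B) | B in A].

End vc_dimension.

(* Labels are booleans, with Y = 1 encoded as [true]. *)
Section classification.
Context {d : measure_display} {X : measurableType d} {R : realType}.
Implicit Types (P : probability (X * bool)%type R) (eta : X -> R).

(* [eta] is a version of x |-> P[Y = 1 | X = x]. *)
Definition is_regression P eta : Prop :=
  [/\ measurable_fun [set: X] eta,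
      forall x, 0 <= eta x <= 1 &
      forall B, measurable B ->
        P (B `*` [set true]) = (\int[pushforward P fst]_(x in B) (eta x)%:E)%E].

Definition bayes eta : X -> bool := fun x => 2^-1 <= eta x.

Definition error P (t : X -> bool) : R := fine (P [set z | z.2 != t z.1]).

Definition loss P (s t : X -> bool) : R := error P t - error P s.

(* The class P(h, S).  As the regression function, hence the Bayes
   classifier, is only determined up to P_X-null sets, an element comes
   with the version satisfying the two pointwise constraints; the loss
   relative to the Bayes classifier does not depend on the version. *)
Definition margin_class (h : R) (S : set (X -> bool)) :
    set (probability (X * bool)%type R * (X -> R)) :=
  [set Pe | [/\ is_regression Pe.1 Pe.2,
                forall x, h <= `|2 * Pe.2 x - 1| &
                S (bayes Pe.2)]].

(* S carries no sigma-algebra: the only measurability asked of an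
   S-valued estimator is that its loss be a random variable, so that the
   expectation in [minimax_risk] makes sense. *)
Definition estimators (n : nat) (h : R) (S : set (X -> bool)) :
    set (n.-tuple (X * bool) -> X -> bool) :=
  [set shat | (forall D, S (shat D)) /\
    forall Pe, margin_class h S Pe ->
      measurable_fun [set: n.-tuple (X * bool)]
        (fun D => loss Pe.1 (bayes Pe.2) (shat D))].
Arguments estimators n h S : clear implicits.

Definition minimax_risk (n : nat) (h : R) (S : set (X -> bool)) : \bar R :=
  ereal_inf [set ereal_sup
      [set 'E_(sample_law Pe.1 n)[fun D => loss Pe.1 (bayes Pe.2) (shat D)]%E
         | Pe in margin_class h S]
    | shat in estimators n h S].

End classification.

(* Main.v *)
From HB Require Import structures.
Require Import Defs.
From mathcomp Require Import all_boot all_order all_algebra.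
From mathcomp Require Import all_classical all_reals all_analysis.
From mathcomp Require Import measurable_realfun ring lra.

Import Order.TTheory GRing.Theory Num.Theory.

Local Open Scope classical_set_scope.
Local Open Scope ring_scope.

(* Assouad's argument on V shattered points.  Put c = max(h, sqrt(V/n)) and
   q = 1/(2nc^2) <= 1/(2V); give mass q to every point but one, which receives
   the rest, and for each s in {0,1}^V let the label of the i-th point agree
   with s_i with probability (1+c)/2.  The loss is then c times the mass of the
   points where the classifier differs from s.  Flipping one bit of mass q
   leaves a per-sample Hellinger affinity at least 1 - qc^2 = 1 - 1/(2n), hence
   at least 1/2 for n samples, so on average over s each such bit is missed
   with probability at least 1/16.  The risk is thus at least
   (V-1)qc/16 >= V/(64nc), and V/(nc) = min(V/(nh), sqrt(V/n)). *)

(** * Finitely supported laws and their samples *)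

Lemma big_tuple_cons (R : Type) (idx : R) (op : Monoid.com_law idx)
    (K : finType) (n : nat) (F : n.+1.-tuple K -> R) :
  \big[op/idx]_(z : n.+1.-tuple K) F z =
  \big[op/idx]_(k : K) \big[op/idx]_(z : n.-tuple K) F [tuple of k :: z].
Proof.
rewrite pair_bigA /=.
rewrite (reindex (fun p : K * n.-tuple K => [tuple of p.1 :: p.2])) //=.
exists (fun z : n.+1.-tuple K => (thead z, [tuple of behead z])) => /=.
  by move=> [k z] _ /=; congr pair; apply/val_inj.
by move=> z _; rewrite [RHS]tuple_eta.
Qed.

Section finite_law.
Context {d : measure_display} {T : measurableType d} {R : realType}.
Context {K : finType} (w : K -> R) (pt : K -> T).

Lemma finite_law_exists : (forall k, 0 <= w k) -> \sum_k w k = 1 ->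
  exists2 P : probability T R,
    forall A, P A = (\sum_k (w k)%:E * \d_(pt k) A)%E &
    forall (D : set T) (f : T -> \bar R), measurable D ->
      measurable_fun D f -> (forall x, D x -> 0 <= f x)%E ->
      (\int[P]_(x in D) f x = \sum_k (w k)%:E * (\d_(pt k) D * f (pt k)))%E.
Proof.
move=> w0 w1.
(* The law is a finite sum of scaled Dirac masses. Since [msum] indexes measures by natural numbers,
   [K] is enumerated, and [sumE] leads back to sums over [K]. *)
pose s : seq {measure set T -> \bar R} :=
  [seq (mscale (NngNum (w0 k)) (dirac (pt k)) : {measure set T -> \bar R})
     | k <- enum K].
pose m0 : {measure set T -> \bar R} := mzero.
pose mu := msum (nth m0 s) #|K|.
have sumE (F : {measure set T -> \bar R} -> \bar R) :
    (\sum_(i < #|K|) F (nth m0 s i) =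
    \sum_k F (mscale (NngNum (w0 k)) (dirac (pt k))))%E.
  have := big_nth m0 xpredT F (r := s) (idx := 0%E) (op := adde).
  rewrite size_map -cardE big_mkord => <-.
  by rewrite big_map enumT.
have muE A : mu A = (\sum_k (w k)%:E * \d_(pt k) A)%E.
  by rewrite /mu /msum (sumE (fun m => m A)).
have muT : mu setT = 1%E.
  rewrite muE -[RHS]/(1%:E) -w1 -sumEFin; apply: eq_bigr => k _.
  by rewrite diracT mule1.
pose pM := Measure_isProbability.Build d T R mu muT.
pose P : probability T R := HB.pack mu pM.
exists P; first exact: muE.
move=> D f mD mf f0.
transitivity (\int[mu]_(x in D) f x)%E; first by [].
rewrite /mu ge0_integral_measure_sum//.
rewrite (sumE (fun m => \int[m]_(x in D) f x)%E).
apply: eq_bigr => k _.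
by rewrite ge0_integral_mscale//= integral_dirac.
Qed.

(** Reduces expectations over samples to finite sums. By induction, Tonelli's theorem peels off the
    first observation, which is integrated by the formula assumed for [P]. *)
Lemma sample_law_integral (P : probability T R) (n : nat)
    (f : n.-tuple T -> \bar R) :
  (forall g : T -> \bar R, measurable_fun setT g -> (forall x, 0 <= g x)%E ->
      (\int[P]_x g x = \sum_k (w k)%:E * g (pt k))%E) ->
  (forall k, 0 <= w k) ->
  measurable_fun setT f -> (forall x, 0 <= f x)%E ->
  (\int[sample_law P n]_D f D = \sum_(z : n.-tuple K)
     (\prod_(j < n) w (tnth z j))%:E * f (map_tuple pt z))%E.
Proof.
move=> PE w0; elim: n f => [|n IH] f mf f0.
  rewrite /= integral_dirac// diracT mul1e.
  rewrite (big_pred1 (nil_tuple K)); last first.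
    by move=> z; apply/esym/eqP/val_inj; case: z => -[].
  by rewrite big_ord0 mul1e; congr f; apply/val_inj.
have mfc := measurableT_comp mf (@measurable_cons_pair d T n).
rewrite [LHS]/= ge0_integral_pushforward// preimage_setT.
rewrite (fubini_tonelli1 (f \o @cons_pair d T n) mfc); last first.
  by move=> x; exact: f0.
rewrite PE; first last.
- by move=> x; apply: integral_ge0 => y _; exact: f0.
- apply: (measurable_fun_fubini_tonelli_F _ mfc) => x; exact: f0.
rewrite big_tuple_cons; apply: eq_bigr => k _.
have mk : measurable_fun setT (fun z : n.-tuple T => f (cons_pair (pt k, z))).
  apply: (measurableT_comp mf (measurable_cons _ _)) => //.
  exact: measurable_id.
rewrite /fubini_F (IH _ mk); last by move=> z; exact: f0.
rewrite ge0_sume_distrr; last first.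
  move=> z _; apply: mule_ge0 => //.
  by rewrite lee_fin prodr_ge0.
apply: eq_bigr => z _.
rewrite muleA -EFinM big_ord_recl tnth0; congr (_%:E * _)%E.
  by congr (_ * _); apply: eq_bigr => j _; rewrite tnthS.
by congr f; apply/val_inj.
Qed.
End finite_law.

(** * Affinity of product weights *)

Lemma sum_tuple_prod (R : comNzRingType) (K : finType) (n : nat) (w : K -> R) :
  \sum_(z : n.-tuple K) \prod_(j < n) w (tnth z j) = (\sum_k w k) ^+ n.
Proof.
elim: n => [|n IH].
  rewrite (big_pred1 (nil_tuple K)); first by rewrite big_ord0.
  by move=> z; apply/esym/eqP/val_inj; case: z => -[].
rewrite big_tuple_cons exprS mulr_suml; apply: eq_bigr => k _.
rewrite -IH mulr_sumr; apply: eq_bigr => z _.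
rewrite big_ord_recl tnth0; congr (_ * _).
by apply: eq_bigr => j _; rewrite tnthS.
Qed.

Lemma bernoulli_ineq (R : realDomainType) (n : nat) (x : R) :
  0 <= x <= 1 -> 1 - n%:R * x <= (1 - x) ^+ n.
Proof.
move=> /andP[x0 x1]; elim: n => [|n IH]; first by rewrite mul0r subr0 expr0.
have := ler_wpM2l (_ : 0 <= 1 - x) IH; rewrite subr_ge0 => /(_ x1).
rewrite exprS; apply: le_trans.
rewrite -natr1.
have : 0 <= n%:R * x ^+ 2 by rewrite mulr_ge0// sqr_ge0.
by move: (n%:R : R) => N; nra.
Qed.

(* AM-GM: [sqrt (a * b) = sqrt (min a b * max a b)] is at most
   [2 * min a b + max a b / 8]. *)
Lemma le_min_addr (R : realFieldType) (a b r : R) :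
  0 <= a -> 0 <= b -> r ^+ 2 <= a * b ->
  r <= 2 * Num.min a b + (a + b) / 8.
Proof.
wlog ab : a b / a <= b => [hw a0 b0 rab|a0 b0 rab].
  have /orP[ab|ba] := le_total a b; first exact: hw.
  by rewrite minC [a + b]addrC; apply: hw => //; rewrite mulrC.
rewrite min_l//; set t := 2 * a + (a + b) / 8.
have t0 : 0 <= t by rewrite /t; lra.
rewrite leNgt; apply/negP => tr.
have r0 : 0 <= r by rewrite ltW// (le_lt_trans t0).
have : t ^+ 2 < r ^+ 2 by rewrite ltr_pXn2r// ?nnegrE.
(* With u = (a + b)/8, (2a + u)^2 = (2a - u)^2 + 8au, and the factor 1/8 makes 8au equal to a^2 +
   ab. *)
have -> : t ^+ 2 = a * b + (a ^+ 2 + (2 * a - (a + b) / 8) ^+ 2).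
  by rewrite /t; field.
by rewrite ltNge (le_trans rab)// lerDl addr_ge0// sqr_ge0.
Qed.

(** Applying [le_min_addr] to each sample and summing bounds the n-th power of the affinity by twice
    the sum of minima plus 2/8, whence 1/8 = (1/2 - 1/4)/2. *)
Lemma affinity_sum_min (R : realFieldType) (K : finType) (n : nat)
    (w w' r : K -> R) :
  (forall k, 0 <= w k) -> (forall k, 0 <= w' k) -> (forall k, 0 <= r k) ->
  (forall k, r k ^+ 2 <= w k * w' k) ->
  \sum_k w k = 1 -> \sum_k w' k = 1 -> 1 / 2 <= (\sum_k r k) ^+ n ->
  1 / 8 <= \sum_(z : n.-tuple K)
    Num.min (\prod_(j < n) w (tnth z j)) (\prod_(j < n) w' (tnth z j)).
Proof.
move=> w0 w'0 r0 rww' w1 w'1.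
move=> h.
have : \sum_(z : n.-tuple K) \prod_(j < n) r (tnth z j) <=
    \sum_(z : n.-tuple K)
       (2 * Num.min (\prod_(j < n) w (tnth z j)) (\prod_(j < n) w' (tnth z j))
       + ((\prod_(j < n) w (tnth z j)) + (\prod_(j < n) w' (tnth z j))) / 8).
  apply: ler_sum => z _; apply: le_min_addr; [exact: prodr_ge0..|].
  rewrite -prodrXl -big_split/=; apply: ler_prod => j _.
  by rewrite rww' sqr_ge0.
rewrite big_split/= -mulr_sumr -mulr_suml big_split/= !sum_tuple_prod w1 w'1.
by rewrite !expr1n; lra.
Qed.

(** * Assouad's lemma on the cube of labellings *)

Section cube.
Context {R : realFieldType} {m : nat}.
Implicit Types (s : {ffun 'I_m -> bool}) (p : 'I_m -> R) (c : R).

Definition flip (i : 'I_m) s : {ffun 'I_m -> bool} :=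
  [ffun j => s j (+) (j == i)].

Lemma flipK i : involutive (flip i).
Proof. by move=> s; apply/ffunP => j; rewrite !ffunE addbK. Qed.

(** In [cube_weight] the boolean records agreement of the label with the bit; with the bit itself as
    argument, the same formula gives the probability of label 1. *)
Definition bit_weight c (b : bool) : R := (if b then 1 + c else 1 - c) / 2.

Definition cube_weight p c s (k : 'I_m * bool) : R :=
  p k.1 * bit_weight c (k.2 == s k.1).

Lemma sum_bit_weight c b : \sum_(y : bool) bit_weight c (y == b) = 1.
Proof. by rewrite big_bool /bit_weight; case: b => /=; field. Qed.

Lemma bit_weight_ge0 c b : 0 <= c <= 1 -> 0 <= bit_weight c b.
Proof. by move=> /andP[c0 c1]; rewrite /bit_weight; case: b; lra. Qed.

Lemma sum_cube_weight p c s : \sum_k cube_weight p c s k = \sum_i p i.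
Proof.
rewrite /cube_weight.
rewrite -(pair_bigA _ (fun i y => p i * bit_weight c (y == s i)))/=.
by apply: eq_bigr => i _; rewrite -mulr_sumr sum_bit_weight mulr1.
Qed.

Lemma cube_weight_ge0 p c s k :
  0 <= c <= 1 -> (forall i, 0 <= p i) -> 0 <= cube_weight p c s k.
Proof. by move=> c01 p0; rewrite mulr_ge0// bit_weight_ge0. Qed.

(* For [k.1 = i], [r k] replaces the geometric mean
   [p i * sqrt (1 - c ^+ 2) / 2] of the two weights by the smaller
   [p i * (1 - c ^+ 2) / 2], which avoids square roots and still gives total
   affinity [1 - p i * c ^+ 2]. *)
Lemma cube_weight_sum_min p c s i n :
  0 <= c <= 1 -> (forall i, 0 <= p i) -> \sum_i p i = 1 ->
  n%:R * (p i * c ^+ 2) <= 1 / 2 ->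
  1 / 8 <= \sum_(z : n.-tuple ('I_m * bool))
    Num.min (\prod_(j < n) cube_weight p c s (tnth z j))
            (\prod_(j < n) cube_weight p c (flip i s) (tnth z j)).
Proof.
move=> c01 p0 p1 npc; have /andP[c0 c1] := c01.
have c21 : c ^+ 2 <= 1 by rewrite expr_le1.
have c20 : 0 <= c ^+ 2 by exact: sqr_ge0.
pose v (l : 'I_m) y := if l == i then p i * ((1 - c ^+ 2) / 2)
  else cube_weight p c s (l, y).
pose r (k : 'I_m * bool) := v k.1 k.2.
have pi1 : p i <= 1 by rewrite -p1 (bigD1 i)//= lerDl sumr_ge0.
apply: (@affinity_sum_min _ _ _ _ _ r).
- by move=> k; exact: cube_weight_ge0.
- by move=> k; exact: cube_weight_ge0.
- move=> k; rewrite /r /v; case: ifP => _; last exact: cube_weight_ge0.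
  by rewrite mulr_ge0// divr_ge0// subr_ge0.
(* At the flipped point the weights are p_i(1 + c)/2 and p_i(1 - c)/2 in some order, and (1 - c^2)^2
   <= 1 - c^2. Elsewhere the two laws coincide. *)
- move=> [l y]; rewrite /r /v /cube_weight /=; case: ifPn => [/eqP->|li].
    rewrite ffunE eqxx addbT.
    have -> : (y == ~~ s i) = ~~ (y == s i) by case: y; case: (s i).
    have -> : p i * bit_weight c (y == s i) * (p i * bit_weight c (~~ (y == s i)))
        = p i ^+ 2 * ((1 - c ^+ 2) / 4).
      by rewrite /bit_weight; case: (y == s i) => /=; field.
    rewrite exprMn; apply: ler_wpM2l; first exact: sqr_ge0.
    by move: (c ^+ 2) c20 c21 => e e0 e1; nra.
  by rewrite ffunE (negbTE li) addbF expr2.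
- by rewrite sum_cube_weight.
- by rewrite sum_cube_weight.
have -> : \sum_k r k = 1 - p i * c ^+ 2.
  rewrite /r -(pair_bigA _ v)/= -p1 [in RHS](bigD1 i)//= (bigD1 i)//=.
  rewrite /v eqxx sumr_const card_bool.
  rewrite (eq_bigr p); last first.
    move=> l li; rewrite /cube_weight (negbTE li)/= -mulr_sumr.
    by rewrite sum_bit_weight mulr1.
  by rewrite mulr2n; move: (\sum_(_ | _) _) => e; field.
apply: le_trans (bernoulli_ineq _ n _ _); first by lra.
by rewrite mulr_ge0//= (le_trans (ler_pM _ _ pi1 c21))// mulr1.
Qed.

(** For every [z] the guess [g z] is wrong for exactly one of [s] and [flip i s], so this pair
    contributes at least the smaller weight. Reindexing by the involution [flip i] counts the sum
    twice, hence e/2. *)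
Lemma assouad_bit (n : nat) (K : finType)
    (W : {ffun 'I_m -> bool} -> K -> R) (g : K -> bool) (i : 'I_m) (e : R) :
  (forall s z, 0 <= W s z) ->
  (forall s, e <= \sum_z Num.min (W s z) (W (flip i s) z)) ->
  #|{ffun 'I_m -> bool}|%:R * (e / 2) <=
    \sum_s \sum_z W s z * (g z != s i)%:R.
Proof.
move=> W0 We; set S := \sum_s _.
suff : \sum_(s : {ffun 'I_m -> bool}) e <= S + S.
  by rewrite sumr_const -mulr_natl; lra.
rewrite [X in S + X](reindex_inj (inv_inj (flipK i))) -big_split/=.
apply: ler_sum => s _; apply: (le_trans (We s)).
rewrite -big_split/=; apply: ler_sum => z _.
rewrite ffunE eqxx addbT.
have -> : (g z != ~~ s i) = ~~ (g z != s i) by case: (g z); case: (s i).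
case: (g z != s i) => /=; rewrite ?mulr1 ?mulr0 ?addr0 ?add0r.
  by rewrite ge_min lexx.
by rewrite ge_min lexx orbT.
Qed.

(** Averaged over [s], each bit other than [i0] costs at least q c (1/8)/2 by [assouad_bit], and
    some [s] does no better than the average. The heavy point [i0] is dropped because its mass may
    be too large for the affinity bound. *)
Lemma assouad_cube (n : nat) p c (i0 : 'I_m) (q : R)
    (g : n.-tuple ('I_m * bool) -> 'I_m -> bool) :
  0 <= c <= 1 -> (forall i, 0 <= p i) -> \sum_i p i = 1 ->
  (forall i, i != i0 -> p i = q) ->
  n%:R * (q * c ^+ 2) <= 1 / 2 ->
  exists s, m.-1%:R * (q * c / 16) <=
    \sum_(z : n.-tuple ('I_m * bool))
      (\prod_(j < n) cube_weight p c s (tnth z j)) *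
      \sum_i p i * c * (g z i != s i)%:R.
Proof.
move=> c01 p0 p1 pq nqc; have /andP[c0 c1] := c01.
apply/existsP; rewrite -[X in is_true X]negbK negb_exists.
apply/negP => /forallP lt.
pose W s (z : n.-tuple ('I_m * bool)) :=
  \prod_(j < n) cube_weight p c s (tnth z j).
have W0 s z : 0 <= W s z by apply: prodr_ge0 => j _; exact: cube_weight_ge0.
have : \sum_(s : {ffun 'I_m -> bool}) m.-1%:R * (q * c / 16) <=
    \sum_(s : {ffun 'I_m -> bool}) \sum_z W s z *
      \sum_i p i * c * (g z i != s i)%:R.
  under [leRHS]eq_bigr => s _ do
    (under eq_bigr => z _ do rewrite mulr_sumr; rewrite exchange_big/=).
  rewrite exchange_big/= (bigD1 i0)//=.
  have -> : \sum_(s : {ffun 'I_m -> bool}) m.-1%:R * (q * c / 16) =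
     \sum_(i | i != i0) #|{ffun 'I_m -> bool}|%:R * (p i * c * (1 / 8 / 2)).
    rewrite [RHS](eq_bigr (fun=> #|{ffun 'I_m -> bool}|%:R * (q * c * (1 / 8 / 2))));
      last by move=> i /pq ->.
    rewrite !sumr_const cardC1 card_ord -[LHS]mulr_natl -[RHS]mulr_natl.
    by move: (_%:R : R) (m.-1%:R : R) => a b; field.
  apply: ler_wpDl.
    by do 2 (apply: sumr_ge0 => ? _); rewrite !mulr_ge0.
  apply: ler_sum => i /pq pi.
  rewrite mulrCA.
  under eq_bigr => s _ do (under eq_bigr => z _ do rewrite mulrCA;
     rewrite -mulr_sumr).
  rewrite -mulr_sumr; apply: ler_wpM2l; first by rewrite mulr_ge0.
  apply: (@assouad_bit n _ W (g ^~ i) i) => // s.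
  by apply: cube_weight_sum_min => //; rewrite pi.
apply/negP; rewrite -ltNge.
apply: ltr_sum => [|s _]; last by rewrite ltNge; exact: lt.
(* Strictness of the summed inequality needs at least one index. *)
by apply/hasP; exists [ffun=> true] => //; rewrite mem_index_enum.
Qed.
End cube.

(** * Shattered points from the VC-dimension *)

Lemma counting_le_size (R : realType) (T : choiceType) (S : set T) (s : seq T) :
  (forall y, S y -> y \in s) -> (counting S <= (size s)%:R%:E :> \bar R)%E.
Proof.
(* [nth] needs a default element and [T] may be empty, so the empty list is treated apart. *)
case: s => [|y0 s'] Ss.
  have -> : S = set0 by apply/seteqP; split => y // /Ss.
  by rewrite /counting asboolT// fset_set0.
set s := y0 :: s' in Ss *.
have Sle : (S #<= `I_(size s))%card.
  apply: card_le_trans (card_image_le (nth y0 s) `I_(size s)).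
  apply: subset_card_le => y /Ss ys /=.
  by exists (index y s); [rewrite /mkset index_mem|rewrite nth_index].
rewrite /counting asboolT; last by apply/finite_set_leP; exists (size s).
by rewrite lee_fin ler_nat; exact: geq_card_fset_set.
Qed.

Lemma vc_dim_shatters (R : realType) (d : measure_display)
    (X : measurableType d) (A : set (set X)) (V : nat) :
  vc_dim R A = V%:R%:E ->
  exists x : 'I_V -> X, forall b : {ffun 'I_V -> bool},
    exists2 B, A B & forall i, (x i \in B) = b i.
Proof.
move=> vcV.
(* Both suprema are finite and concern integers, so a gap of 1/2 suffices to see that they are
   attained. *)
have half : 0 < 2^-1 :> R by rewrite invr_gt0.
have shV : shatter_coeff R A V = (2 ^ V)%:R%:E.
  have fV : vc_dim R A \is a fin_num by rewrite vcV.
  have [_ /= [N shN <-]] := ub_ereal_sup_adherent half fV.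
  rewrite -/(vc_dim R A) vcV -EFinB lte_fin => VN.
  have NV : (N%:R%:E <= vc_dim R A)%E by apply: ereal_sup_ubound; exists N.
  move: NV; rewrite vcV lee_fin ler_nat => NV.
  suff <- : N = V by [].
  apply/eqP; rewrite eqn_leq NV /= -ltnS -(ltr_nat R) -natr1.
  by move: VN; lra.
have fS : shatter_coeff R A V \is a fin_num by rewrite shV.
have [_ /= [C CV <-]] := ub_ereal_sup_adherent half fS.
rewrite -/(shatter_coeff R A V) shV -EFinB => lt.
have /card_set_bijP[x [xC xinj xsurj]] : ([set: 'I_V] #= C)%card.
  by rewrite card_eq_sym (card_eq_trans CV)// card_II.
exists x => b.
pose phi (b : {ffun 'I_V -> bool}) : set X :=
  [set y | exists2 i, b i & x i = y].
(* If the pattern [b] were missing, every trace on [C] would be [phi b'] with [b'] different from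
   [b], leaving at most 2^V - 1 traces. *)
apply: contrapT => nb.
have := @counting_le_size R _ [set B `&` C | B in A]
  [seq phi b' | b' <- enum (predC1 b)].
rewrite size_map -cardE cardC1 card_ffun card_bool card_ord => le.
suff : ((2 ^ V)%:R%:E - 2^-1%:E < (2 ^ V).-1%:R%:E :> \bar R)%E.
  have V0 : (0 < 2 ^ V)%N by rewrite expn_gt0.
  rewrite -EFinB lte_fin -[in ltLHS](prednK V0) -natr1.
  by lra.
apply: (lt_le_trans lt); apply: le => _ [B AB <-].
apply/mapP; exists [ffun i => x i \in B]; last first.
  apply/seteqP; split => y /=.
    move=> [By Cy]; have [i _ xiy] := xsurj _ Cy.
    by exists i => //; rewrite ffunE xiy mem_set.
  move=> [i + <-]; rewrite ffunE => /set_mem Bxi; split => //.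
  exact: xC.
rewrite mem_enum; apply/eqP => bE; apply: nb.
by exists B => // i; rewrite -bE ffunE.
Qed.

(** * Distributions in the margin class realising the cube *)

Section cube_distribution.
Context {d : measure_display} {X : measurableType d} {R : realType} {m : nat}.
Context (x : 'I_m -> X) (p : 'I_m -> R) (c : R) (s : {ffun 'I_m -> bool}).
Context (B : set X).
Context (mB : measurable B) (xB : forall i, (x i \in B) = s i).
Context (c01 : 0 < c <= 1) (p0 : forall i, 0 <= p i) (p1 : \sum_i p i = 1).

(** The margin and Bayes conditions are pointwise on the whole of [X], so the regression function is
    prescribed off the support too, through a set [B] that cuts out [s] on the shattered points. *)
Definition cube_eta (y : X) : R := bit_weight c (y \in B).

Lemma bayes_cube_eta : bayes cube_eta = fun y => y \in B.
Proof.
have /andP[c0 _] := c01.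
apply/funext => y; rewrite /bayes /cube_eta /bit_weight.
by case: (y \in B) => /=; [|apply/negbTE; rewrite -ltNge]; lra.
Qed.

Lemma measurable_cube_eta : measurable_fun setT cube_eta.
Proof.
have -> : cube_eta = fun y => (1 - c) / 2 + c * \1_B y.
  apply/funext => y; rewrite /cube_eta /bit_weight indicE.
  by case: (y \in B) => /=; field.
apply: measurable_funD; first exact: measurable_cst.
apply: measurable_funM; first exact: measurable_cst.
exact: measurable_indic.
Qed.

Lemma cube_distribution (h : R) (A : set (set X)) : h <= c -> A B ->
  exists P : probability (X * bool)%type R,
  [/\ margin_class h (indicators A) (P, cube_eta),
      forall t, loss P (bayes cube_eta) t =
        \sum_i p i * c * (t (x i) != s i)%:R &
      forall n (f : n.-tuple (X * bool) -> R),
        measurable_fun setT f -> (forall D, 0 <= f D) ->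
        ('E_(sample_law P n)[f] = (\sum_(z : n.-tuple ('I_m * bool))
          (\prod_(j < n) cube_weight p c s (tnth z j)) *
          f (map_tuple (fun k => (x k.1, k.2)) z))%:E)%E].
Proof.
move=> hc AB; have /andP[c0 c1] := c01.
have c01' : 0 <= c <= 1 by rewrite ltW.
pose pt (k : 'I_m * bool) : X * bool := (x k.1, k.2).
have w0 k : 0 <= cube_weight p c s k by exact: cube_weight_ge0.
have w1 : \sum_k cube_weight p c s k = 1 by rewrite sum_cube_weight.
have [P PE PI] := finite_law_exists _ pt w0 w1.
exists P; split.
- split => /=.
  + split.
    * exact: measurable_cube_eta.
    * move=> y; rewrite /cube_eta /bit_weight.
      by case: (y \in B) => /=; apply/andP; split; lra.
    * move=> D mD.
      rewrite ge0_integral_pushforward//; first last.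
      - by move=> y _; rewrite lee_fin /cube_eta bit_weight_ge0.
      - apply/measurable_EFinP; apply: measurable_funTS.
        exact: measurable_cube_eta.
      rewrite PE PI; first last.
      - by move=> y _ /=; rewrite lee_fin /cube_eta bit_weight_ge0.
      - apply/measurable_EFinP; apply: measurable_funTS.
        apply: (measurableT_comp measurable_cube_eta); exact: measurable_fst.
      - rewrite -[_ @^-1` _]setTI; exact: measurable_fst.
      rewrite (eq_bigr (fun k => (cube_weight p c s k *
        ((x k.1 \in D) && k.2)%:R)%:E)); last first.
        move=> [i y] _ /=; rewrite diracE EFinM; congr (_ * (_%:R)%:E)%E.
        rewrite in_setX/=; congr (nat_of_bool (_ && _)).
        by case: y; [rewrite mem_set|rewrite memNset].
      rewrite [RHS](eq_bigr (fun k => (cube_weight p c s k *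
        ((x k.1 \in D)%:R * bit_weight c (s k.1)))%:E)); last first.
        move=> [i y] _ /=; rewrite diracE !EFinM /cube_eta xB.
        by congr (_ * (_%:R%:E * _))%E.
      rewrite !sumEFin; congr (_%:E).
      rewrite -(pair_bigA _ (fun i y => cube_weight p c s (i, y) *
        ((x i \in D) && y)%:R))/=.
      rewrite -(pair_bigA _ (fun i y => cube_weight p c s (i, y) *
        ((x i \in D)%:R * bit_weight c (s i))))/=.
      (* At the i-th point only label 1 counts on the left; on the right the weights of both labels
         add up to [p i], multiplied by the regression function. *)
      apply: eq_bigr => i _; rewrite -mulr_suml !big_bool /cube_weight/=.
      rewrite -mulrDr; case: (x i \in D); last by rewrite /= !(mulr0, mul0r) addr0.
      by rewrite /bit_weight; case: (s i) => /=; field.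
  + move=> y; rewrite /cube_eta /bit_weight.
    case: (y \in B) => /=.
      by rewrite ger0_norm; lra.
    by rewrite ler0_norm; lra.
  + by rewrite bayes_cube_eta; exists B.
- have errE t : error P t =
      \sum_i p i * \sum_y bit_weight c (y == s i) * (y != t (x i))%:R.
    rewrite /error PE.
    under eq_bigr => k _ do rewrite diracE -EFinM.
    rewrite sumEFin /=.
    rewrite -(pair_bigA _ (fun i y => cube_weight p c s (i, y) *
      ((x i, y) \in [set z : X * bool | z.2 != t z.1])%:R))/=.
    apply: eq_bigr => i _; rewrite mulr_sumr; apply: eq_bigr => y _.
    by rewrite /cube_weight/= -mulrA mem_setE.
  move=> t; rewrite /loss !errE -sumrB bayes_cube_eta; apply: eq_bigr => i _.
  (* Disagreeing with the Bayes label at the i-th point costs (1 + c)/2 - (1 - c)/2 = c. *)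
  rewrite -mulrBr -mulrA !big_bool xB /bit_weight.
  by case: (s i); case: (t (x i)) => /=; field.
- move=> n f mf f0; rewrite unlock.
  rewrite (sample_law_integral (cube_weight p c s) pt)//.
  + by rewrite -sumEFin; apply: eq_bigr => z _; rewrite EFinM.
  + move=> g mg g0; rewrite PI//.
    by apply: eq_bigr => k _; rewrite diracT mul1e.
  + exact/measurable_EFinP.
Qed.

End cube_distribution.

(** * The minimax lower bound *)

Lemma minimax_risk_ge (R : realType) (d : measure_display)
    (X : measurableType d) (h c q : R) (A : set (set X)) (V n : nat) :
  (forall B, A B -> measurable B) -> vc_dim R A = V%:R%:E -> (0 < V)%N ->
  h <= c -> 0 < c <= 1 -> 0 <= q -> V%:R * q <= 1 ->
  n%:R * (q * c ^+ 2) <= 1 / 2 ->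
  ((V.-1%:R * (q * c / 16))%:E <= minimax_risk n h (indicators A))%E.
Proof.
case: V => // V mA vcV _ hc c01 q0 Vq nqc; have /andP[c0 c1] := c01.
have [x xsh] := vc_dim_shatters _ _ _ _ _ vcV.
have c01' : 0 <= c <= 1 by rewrite ltW.
(* After the case analysis the dimension is [V.+1]; [ord0] is the heavy point. *)
pose p (i : 'I_V.+1) := if i == ord0 then 1 - V%:R * q else q.
have p0 i : 0 <= p i.
  rewrite /p; case: ifP => // _.
  by move: Vq; rewrite -natr1 mulrDl mul1r; lra.
have p1 : \sum_i p i = 1.
  rewrite big_ord_recl /p eqxx (eq_bigr (fun=> q))//.
  by rewrite sumr_const card_ord mulr_natl subrK.
apply: le_ereal_inf_tmp => _ [shat [Sshat mshat] <-].
(* Read at the shattered points, the estimator guesses the bits of [s]; the bad [s] is chosen after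
   the estimator. *)
have [|s hs] := @assouad_cube R V.+1 n p c ord0 q
  (fun z i => shat (map_tuple (fun k => (x k.1, k.2)) z) (x i)) c01' p0 p1
  _ nqc.
  by move=> i /negbTE; rewrite /p => ->.
have [B AB xB] := xsh s.
have [P [PM lossE EP]] :=
  cube_distribution _ _ _ _ _ (mA _ AB) xB c01 p0 p1 h A hc AB.
apply: (@le_trans _ _ ('E_(sample_law P n)[
    fun D => loss P (bayes (cube_eta c B)) (shat D)])%E); last first.
  by apply: ereal_sup_ubound; exists (P, cube_eta c B).
rewrite EP; last 2 first.
- exact: (mshat _ PM).
- move=> D; rewrite lossE; apply: sumr_ge0 => i _.
  by rewrite !mulr_ge0// ltW.
rewrite lee_fin; apply: (le_trans hs); rewrite le_eqVlt; apply/orP; left.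
by apply/eqP; apply: eq_bigr => z _; rewrite lossE.
Qed.

(* The quotient is taken in \bar R, where 0^-1 = +oo: it is +oo for h = 0. *)
Theorem theorem4 (R : realType) :
  exists kappa : R, 0 < kappa /\
    forall (d : measure_display) (X : measurableType d) (h : R)
      (A : set (set X)) (V n : nat),
    0 <= h <= 1 ->
    (forall B, A B -> measurable B) ->
    vc_dim R A = (V%:R)%:E ->
    (2 <= V)%N ->
    (V <= n)%N ->
    (kappa%:E * Order.min ((V%:R)%:E / (n%:R * h)%:E)
                          (Num.sqrt (V%:R / n%:R))%:E
       <= minimax_risk n h (indicators A))%E.
Proof.
(* Since q c = 1/(2nc), the bound (V - 1)qc/16 is (V - 1)/(32nc), and V >= 2 gives V - 1 >= V/2. *)
exists (1 / 64); split=> [|d X h A V n /andP[h0 h1] mA vcV V2 Vn]; first by [].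
have V0 : 0 < V%:R :> R by rewrite ltr0n (leq_trans _ V2).
have n0 : 0 < n%:R :> R by rewrite ltr0n (leq_trans _ Vn)// (leq_trans _ V2).
have Vn' : V%:R <= n%:R :> R by rewrite ler_nat.
set t := Num.sqrt (V%:R / n%:R).
have t0 : 0 < t by rewrite sqrtr_gt0 divr_gt0.
(* With n >= V, [c] stays at most 1, as the label probability (1 + c)/2 requires. *)
have t1 : t <= 1 by rewrite -sqrtr1 ler_sqrt// ler_pdivrMr ?mul1r.
have t2 : t ^+ 2 = V%:R / n%:R by rewrite sqr_sqrtr// divr_ge0// ltW.
pose c := Num.max h t.
have hc : h <= c by rewrite le_max lexx.
have tc : t <= c by rewrite le_max lexx orbT.
have c0 : 0 < c by exact: lt_le_trans tc.
have c1 : c <= 1 by rewrite ge_max h1.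
pose q := (2 * n%:R * c ^+ 2)^-1.
have D0 : 0 < 2 * n%:R * c ^+ 2 by rewrite !mulr_gt0.
have q0 : 0 < q by rewrite invr_gt0.
have Vq : V%:R * q <= 1.
  rewrite ler_pdivrMr// mul1r.
  have : t ^+ 2 <= c ^+ 2 by rewrite ler_sqr// nnegrE ltW.
  rewrite t2 ler_pdivrMr// => H.
  apply: (le_trans H); rewrite mulrC -mulrA.
  by have := mulr_gt0 n0 (exprn_gt0 2 c0); lra.
have nqc : n%:R * (q * c ^+ 2) <= 1 / 2.
  rewrite le_eqVlt; apply/orP; left; apply/eqP.
  by rewrite /q; field; rewrite !lt0r_neq0.
have := minimax_risk_ge R d X h c q A V n mA vcV (ltnW V2) hc _ (ltW q0) Vq nqc.
rewrite c0 c1 => /(_ isT); apply: le_trans.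
have minle : (Order.min (V%:R%:E / (n%:R * h)%:E) t%:E <=
    (V%:R / (n%:R * c))%:E)%E.
  (* If t <= h then c = h > 0 and the first term is used. Otherwise c = t and V/(nt) = t; the case h
     = 0 falls here, so the infinite quotient is never evaluated. *)
  rewrite ge_min; have [th|ht] := leP t h.
    have -> : c = h by rewrite /c max_l.
    have h0' : 0 < h by exact: lt_le_trans th.
    by rewrite inver mulf_eq0 !gt_eqF//= EFinM lexx.
  have -> : c = t by rewrite /c max_r// ltW.
  apply/orP; right; rewrite lee_fin ler_pdivlMr ?mulr_gt0//.
  by rewrite mulrCA -expr2 t2 mulrCA divff ?mulr1// gt_eqF.
apply: (@le_trans _ _ ((1 / 64)%:E * (V%:R / (n%:R * c))%:E)%E).
  by apply: lee_wpmul2l => //; rewrite lee_fin.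
rewrite -EFinM lee_fin.
have -> : V.-1%:R = V%:R - 1 :> R by rewrite -subn1 natrB// ltnW.
have -> : (V%:R - 1) * (q * c / 16) = 1 / 64 * ((2 * (V%:R - 1)) / (n%:R * c)).
  by rewrite /q; field; rewrite !lt0r_neq0.
apply: ler_wpM2l => //; apply: ler_wpM2r.
  by rewrite invr_ge0 mulr_ge0// ltW.
have : 2 <= V%:R :> R by rewrite ler_nat.
by lra.
Qed.
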